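(* Let $G$ be a connected finite simple graph of order $n$. Then \[A(G) \geq \frac{n+2}{3},\] with equality if and only if $G$ is a path. In particular, $D(G) = A(G)/n > 1/3$ for every connected graph $G$.
   Context: For a connected finite simple graph $G$ with vertex set $V$, a subset $U\subseteq V$ is a connected set if the subgraph of $G$ induced by $U$ is connected. Let $\mathcal C(G)$ be the collection of all nonempty connected sets of $G$, $N(G)=|\mathcal C(G)|$, $S(G)=\sum_{U\in\mathcal C(G)}|U|$, and $A(G)=S(G)/N(G)$ (the average size of a nonempty connected set). The density is $D(G)=A(G)/n$. *)

(* Defs.v *)
From HB Require Import structures.
From mathcomp Require Import all_boot all_order all_algebra.
Set Implicit Arguments.
Unset Strict Implicit.
Unset Printing Implicit Defensive.
Import Order.TTheory GRing.Theory Num.Theory.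
Local Open Scope ring_scope.

Record sgraph := SGraph {
  vertex :> finType;
  edge : rel vertex;
  edge_sym : symmetric edge;
  edge_irr : irreflexive edge }.

(* The graph without vertices satisfies this predicate; hence the nonemptiness
   conditions in [conn_sets] and in the theorem. *)
Definition connected (G : sgraph) : bool :=
  [forall x : G, forall y : G, connect (@edge G) x y].

Definition gorder (G : sgraph) : nat := #|G|.

Section Induced.
Variables (G : sgraph) (U : {set G}).

Definition induced_edge : rel {x : G | x \in U} :=
  fun x y => edge (val x) (val y).

Lemma induced_edge_sym : symmetric induced_edge.
Proof. by move=> x y; apply: edge_sym. Qed.

Lemma induced_edge_irr : irreflexive induced_edge.
Proof. by move=> x; apply: edge_irr. Qed.

Definition induced : sgraph := SGraph induced_edge_sym induced_edge_irr.

End Induced.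

Definition connected_set (G : sgraph) (U : {set G}) : bool :=
  connected (induced U).

Definition conn_sets (G : sgraph) : {set {set G}} :=
  [set U : {set G} | (U != set0) && connected_set U].

Definition num_conn (G : sgraph) : nat := #|conn_sets G|.

Definition sum_conn (G : sgraph) : nat := (\sum_(U in conn_sets G) #|U|)%N.

Definition avg_conn (G : sgraph) : rat := (sum_conn G)%:R / (num_conn G)%:R.

Definition density (G : sgraph) : rat := avg_conn G / (gorder G)%:R.

Definition isomorphic (G H : sgraph) : Prop :=
  exists f : G -> H,
    bijective f /\ forall x y : G, edge (f x) (f y) = edge x y.

Section PathGraph.
Variable n : nat.

Definition path_edge : rel 'I_n :=
  fun i j => (i.+1 == j :> nat) || (j.+1 == i :> nat).

Lemma path_edge_sym : symmetric path_edge.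
Proof. by move=> i j; rewrite /path_edge orbC. Qed.

Lemma path_edge_irr : irreflexive path_edge.
Proof. by move=> i; rewrite /path_edge orbb gtn_eqF. Qed.

Definition path_graph : sgraph := SGraph path_edge_sym path_edge_irr.

End PathGraph.

Definition is_path (G : sgraph) : Prop :=
  exists m : nat, isomorphic G (path_graph m).

(* Main.v *)
(* Let N_v be the number of connected sets through a vertex v, let C range over
   the components of G - v, with m_C = |C|, N(C) the number of connected sets
   inside C and 1 + m_C + g_C the number of those through v inside C + v.
   Connected sets through v have average size at least (n+1)/2, so by induction
   on the order, applied to each C, it suffices to find v with
     2 sum_C N(C) (n - m_C) <= (n-1) N_v,   where  N_v >= prod_C (1 + m_C + g_C).
   A connected set U inside C at distance k from v is determined by k and by its
   union W with a geodesic from v to U, and k <= min(|W| - 1, ecc v).  Since the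
   connected sets W through v in C + v contain a chain with sizes 1, ..., m_C + 1,
     2 N(C) <= m_C (m_C + 1) + 2 (ecc v) g_C.
   If 2 ecc v <= n - 1 the required inequality follows, and it is strict unless
   there are at most two components and each is exhausted by a geodesic from v;
   then some distance is n - 1 and G is a path.  If every eccentricity exceeds
   (n-1)/2, a vertex v of least eccentricity e has n = 2e and a unique vertex at
   distance e; either G is again a path, or G - v is connected and only one set U
   has k = e, which leaves enough room. *)
Require Import Defs.
From mathcomp Require Import all_boot all_order all_algebra.
From mathcomp Require Import zify.
Set Implicit Arguments.
Unset Strict Implicit.
Unset Printing Implicit Defensive.
Import Order.TTheory GRing.Theory Num.Theory.
Local Open Scope nat_scope.

(** * Connected sets and components *)

Section ConnectedSets.
Variable G : sgraph.
Implicit Types (A B C H U W X Y : {set G}) (x y v : G).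

(** Cut criterion: a path from [x] to [y] has a first edge leaving [A]; conversely, the vertices
    reachable from [x] inside [U] would form a cut without outgoing edge. Being stated in [G], it
    avoids the subtype of [induced U]. *)
Lemma connected_setP U :
  reflect (forall A x y, A \subset U -> x \in A -> y \in U -> y \notin A ->
             exists a b, [/\ a \in A, b \in U, b \notin A & edge a b])
          (connected_set U).
Proof.
apply: (iffP idP) => [connU A x y sAU xA yU yNA | cutU].
  have /forallP/(_ (Sub x (subsetP sAU x xA)))/forallP/(_ (Sub y yU)) := connU.
  case/connectP=> p; elim: p x xA => [|z p IHp] x xA /=.
    by move=> _ /(congr1 val) /= eq_yx; rewrite eq_yx xA in yNA.
  case/andP=> xz pz def_y.
  case zA: (val z \in A); last first.
    by exists x, (val z); rewrite xA zA (valP z).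
  case: z xz pz zA def_y => z zU xz pz zA def_y.
  apply: (IHp z zA).
    by rewrite (_ : Sub z _ = Sub z zU) //; apply: val_inj.
  by rewrite (_ : Sub z (subsetP _ _ _) = Sub z zU) //; apply: val_inj.
apply/forallP=> x; apply/forallP=> y; apply: contraT => xNy.
have [||||a [b []]] := cutU [set val z | z in connect (@edge (induced U)) x] (val x) (val y).
- by apply/subsetP=> _ /imsetP[z _ ->]; apply: valP.
- by apply: imset_f; apply: connect0.
- exact: valP.
- by apply: contra xNy => /imsetP[z xz /val_inj ->].
case/imsetP=> z xz -> bU bN zb; case/negP: bN.
apply/imsetP; exists (Sub b bU) => //.
by apply: connect_trans xz (connect1 _).
Qed.

(* By symmetry of the edge relation only the cuts whose inner side contains a
   given vertex have to be examined. *)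
Lemma connected_set_rooted v U : v \in U ->
  (forall A y, A \subset U -> v \in A -> y \in U -> y \notin A ->
     exists a b, [/\ a \in A, b \in U, b \notin A & edge a b]) ->
  connected_set U.
Proof.
move=> vU cutU; apply/connected_setP=> A x y sAU xA yU yNA.
have [vA | vNA] := boolP (v \in A); first exact: cutU vA yU yNA.
have [||||a [b []]] := cutU (U :\: A) x.
- exact: subsetDl.
- by rewrite inE vNA.
- exact: (subsetP sAU).
- by rewrite inE xA.
rewrite !inE => /andP[aNA aU] bU; rewrite bU andbT negbK => bA ab.
by exists b, a; rewrite edge_sym.
Qed.

Lemma connected_set1 v : connected_set [set v].
Proof.
apply: (@connected_set_rooted v) => [|A y _ vA]; first exact: set11.
by move=> /set1P-> /negP.
Qed.

Lemma connected_setU U W x : connected_set U -> connected_set W ->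
  x \in U -> x \in W -> connected_set (U :|: W).
Proof.
move=> cU cW xU xW; apply: (@connected_set_rooted x) => [|A y sA xA yUW yNA].
  by rewrite inE xU.
have cut Z : connected_set Z -> Z \subset U :|: W -> x \in Z -> y \in Z ->
    exists a b, [/\ a \in A, b \in U :|: W, b \notin A & edge a b].
  move=> /connected_setP cZ /subsetP sZ xZ yZ.
  have [||||a [b []]] := cZ (A :&: Z) x y.
  - exact: subsetIr.
  - by rewrite inE xA.
  - by [].
  - by rewrite inE (negPf yNA).
  rewrite !inE => /andP[aA _] bZ; rewrite bZ andbT => bNA ab.
  by exists a, b; split=> //; have := sZ b bZ; rewrite inE.
by case/setUP: yUW; apply: cut; rewrite ?subsetUl ?subsetUr.
Qed.

Lemma connected_setU1 U a b : connected_set U -> a \in U -> edge a b ->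
  connected_set (b |: U).
Proof.
move=> cU aU ab; apply: (@connected_set_rooted a) => [|A y sA aA].
  by rewrite !inE aU orbT.
have [sUA | /subsetPn[z zU zNA] _ _] := boolP (U \subset A).
  case/setU1P=> [-> bNA | /(subsetP sUA) -> //].
  by exists a, b; rewrite setU11.
have [||||c [d []]] := (connected_setP _ cU) (A :&: U) a z.
- exact: subsetIr.
- by rewrite inE aA.
- by [].
- by rewrite inE (negPf zNA).
rewrite !inE => /andP[cA _] dU; rewrite dU andbT => dNA cd.
by exists c, d; rewrite !inE dU orbT.
Qed.

Lemma connected_set_grow X U x y : connected_set X -> U \subset X ->
  connected_set U -> x \in U -> y \in X -> y \notin U ->
  exists2 z, z \in X :\: U & connected_set (z |: U).
Proof.
move=> cX sUX cU xU yX yNU.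
have [a [b [aU bX bNU ab]]] := connected_setP _ cX U x y sUX xU yX yNU.
by exists b; [rewrite inE bNU | apply: connected_setU1 ab].
Qed.

(** A largest proper connected subset of [Y] through [y] can still grow by one vertex, so it misses
    exactly that vertex. *)
Lemma noncut_vertex Y y : connected_set Y -> y \in Y -> 1 < #|Y| ->
  exists u, [/\ u \in Y, u != y & connected_set (Y :\ u)].
Proof.
move=> cY yY gt1Y.
pose P U := [&& connected_set U, y \in U & U \proper Y].
have P1 : P [set y].
  by rewrite /P connected_set1 set11 properEcard sub1set yY cards1.
case: (arg_maxnP (fun U => #|U|) P1) => U /and3P[cU yU ltUY] maxU.
have [sUY [z zY zNU]] := properP ltUY.
have [u] := connected_set_grow cY sUY cU yU zY zNU.
rewrite inE => /andP[uNU uY] cuU.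
have def_Y : u |: U = Y.
  apply/eqP; apply: contraT => ne_uUY.
  have /maxU /= : P (u |: U).
    by rewrite /P cuU inE yU orbT properEneq ne_uUY subUset sub1set uY.
  by rewrite cardsU1 uNU add1n ltnn.
exists u; split=> //; first by apply: contraNneq uNU => ->.
by rewrite -def_Y setU1K.
Qed.

Lemma rooted_chain Y y : connected_set Y -> y \in Y ->
  exists B : nat -> {set G}, forall k, 0 < k <= #|Y| ->
    [/\ connected_set (B k), y \in B k, B k \subset Y & #|B k| = k].
Proof.
move Dn: #|Y| => n; elim: n Y Dn => [|n IHn] Y cardY cY yY.
  by move/eqP: cardY; rewrite cards_eq0 => /eqP Y0; rewrite Y0 inE in yY.
case: n => [|n] in IHn cardY *.
    exists (fun=> Y) => k; rewrite andbC -eqn_leq => /eqP ->.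
    by rewrite cardY.
have [|u [uY ne_uy cYu]] := noncut_vertex cY yY; first by rewrite cardY.
have [||B Bk] := IHn (Y :\ u) _ cYu.
- by have:= cardsD1 u Y; rewrite uY cardY; case.
- by rewrite !inE eq_sym ne_uy.
exists (fun k => if k == n.+2 then Y else B k) => k /andP[k_gt0].
rewrite leq_eqVlt; case: eqP => [-> _ | _ /= le_kn] //.
have [|cB yB sB ?] := Bk k; first by rewrite k_gt0.
by split=> //; apply: subset_trans sB (subD1set _ _).
Qed.

(** For [H] a singleton these are the connected sets through a vertex; larger roots arise when the
    induction on average sizes adds a vertex to the root. *)
Definition rooted H X : {set {set G}} :=
  [set U : {set G} | connected_set U && (H \subset U) && (U \subset X)].

Lemma rootedP H X U :
  reflect [/\ connected_set U, H \subset U & U \subset X] (U \in rooted H X).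
Proof. by rewrite inE -andbA; apply: and3P. Qed.

Lemma leq_card_rooted Y y : connected_set Y -> y \in Y ->
  #|Y| <= #|rooted [set y] Y|.
Proof.
move=> cY yY; have [B Bk] := rooted_chain cY yY.
rewrite -{1}[#|Y|]card_ord.
have injB : injective (fun k : 'I_#|Y| => B k.+1).
  move=> i j eqB; apply: val_inj; apply: succn_inj => /=.
  have [|_ _ _ <-] := Bk i.+1; first exact: ltn_ord.
  by rewrite eqB; have [|_ _ _ ->] := Bk j.+1; first exact: ltn_ord.
rewrite -cardsT -(card_imset _ injB) subset_leq_card //.
apply/subsetP=> _ /imsetP[i _ ->]; apply/rootedP.
by have [|? ? ? _] := Bk i.+1; rewrite ?sub1set //; apply: ltn_ord.
Qed.

(** The component of [x] in the subgraph induced by [X], written as a union of connected sets so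
    that maximality is immediate; it is empty for [x] outside [X]. *)
Definition component X x : {set G} := \bigcup_(U in rooted [set x] X) U.

Lemma component_sub X x : component X x \subset X.
Proof. by apply/bigcupsP=> U /rootedP[]. Qed.

Lemma component_id X x : x \in X -> x \in component X x.
Proof.
move=> xX; apply/bigcupP; exists [set x]; last exact: set11.
by apply/rootedP; rewrite connected_set1 !sub1set set11.
Qed.

Lemma component_connected X x : x \in X -> connected_set (component X x).
Proof.
move=> xX; apply: (@connected_set_rooted x) => [|A y sA xA].
  exact: component_id.
case/bigcupP=> U xUX yU yNA; have [cU xU sU] := rootedP _ _ _ xUX.
rewrite sub1set in xU.
have [||||a [b []]] := connected_setP _ cU (A :&: U) x y.
- exact: subsetIr.
- by rewrite inE xA.
- by [].
- by rewrite inE (negPf yNA).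
rewrite !inE => /andP[aA _] bU; rewrite bU andbT => bNA ab.
by exists a, b; split=> //; apply/bigcupP; exists U.
Qed.

Lemma component_max X x y U : connected_set U -> U \subset X ->
  y \in U -> y \in component X x -> U \subset component X x.
Proof.
move=> cU sUX yU /bigcupP[W xW yW]; have [cW sxW sWX] := rootedP _ _ _ xW.
apply: subset_trans (subsetUl U W) _.
rewrite /component (bigcup_max (U :|: W)) //; apply/rootedP; split.
- exact: connected_setU yU yW.
- exact: subset_trans sxW (subsetUr _ _).
- by rewrite subUset sUX.
Qed.

Lemma component_edge X x a b : a \in component X x -> b \in X -> edge a b ->
  b \in component X x.
Proof.
move=> aC bX ab.
have aX := subsetP (component_sub X x) a aC.
have /subsetP-> // : [set b; a] \subset component X x.
  apply: component_max aC; last by rewrite !inE eqxx orbT.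
    by apply: connected_setU1 ab; rewrite ?connected_set1 ?set11.
  by rewrite subUset !sub1set bX.
by rewrite !inE eqxx.
Qed.

Lemma component_eq X x y : y \in X -> y \in component X x ->
  component X y = component X x.
Proof.
move=> yX yC.
have cC : connected_set (component X x).
  case/bigcupP: yC => U /rootedP[_ sxU sUX _]; apply: component_connected.
  by apply: (subsetP sUX); rewrite -sub1set.
have sxy : component X x \subset component X y.
  by apply: (component_max cC (component_sub _ _) yC); apply: component_id.
apply/eqP; rewrite eqEsubset sxy andbT.
apply: (component_max _ (component_sub _ _) _ yC); last exact: component_id.
exact: component_connected.
Qed.

(** Given a cut side [A] containing [v], apply the cut criterion in [X] to [A :|: C]: the edge found
    starts in [A], since edges of [X] leaving the component [C] end in [v]. *)
Lemma connected_setD_component X v x : connected_set X -> v \in X ->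
  x \in X :\ v -> connected_set (X :\: component (X :\ v) x).
Proof.
move=> cX vX xXv; set C := component _ _.
have vNC : v \notin C.
  by apply/negP=> /(subsetP (component_sub _ _)); rewrite setD11.
apply: (@connected_set_rooted v) => [|A y sA vA]; first by rewrite inE vNC.
rewrite !inE => /andP[yNC yX] yNA.
have [||||a [b []]] := connected_setP _ cX (A :|: C) v y.
- rewrite subUset (subset_trans sA (subsetDl _ _)).
  exact: subset_trans (component_sub _ _) (subD1set _ _).
- by rewrite inE vA.
- by [].
- by rewrite inE negb_or yNA.
rewrite !inE => /orP[aA | aC] bX /norP[bNA bNC] ab.
  by exists a, b; rewrite inE bNC.
have bv : b \in X :\ v by rewrite !inE bX (contraNneq _ bNA) // => ->.
by rewrite (component_edge aC bv ab) in bNC.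
Qed.

End ConnectedSets.

(** * Average size of the connected sets containing a given one *)

Section RootedAverage.
Variable G : sgraph.
Implicit Types (A B C H U W X Y : {set G}) (x y v : G).

Lemma big_rooted_split H X h v (F : {set G} -> nat) :
    h \in H -> H \subset X :\ v ->
  \sum_(U in rooted H X) F U =
    \sum_(U in rooted (v |: H) X) F U +
    \sum_(U in rooted H (component (X :\ v) h)) F U.
Proof.
move=> hH sHXv; rewrite (bigID (fun U => v \in U)) /=; congr (_ + _).
  apply: eq_bigl => U; rewrite !inE subUset sub1set.
  by case: (v \in U); rewrite ?(andbT, andbF).
apply: eq_bigl => U; rewrite !inE -!andbA; apply: andb_id2l => cU.
apply: andb_id2l => sHU; apply/andP/idP => [[sUX vNU] | sUC].
  apply: component_max cU _ (subsetP sHU h hH) _; first by rewrite subsetD1 sUX.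
  exact: component_id (subsetP sHXv h hH).
by apply/andP; rewrite -subsetD1 (subset_trans sUC) ?component_sub.
Qed.

(** Glue each connected [U] in the component with each connected [B] through [v] in the rest of [X].
    The union is connected because [v |: H] is, its traces give back [U] and [B], and by
    [leq_card_rooted] there are at least as many [B] as vertices in the rest. *)
Lemma leq_card_rooted_setU1 H X h v : connected_set X -> h \in H ->
    v \in X -> connected_set (v |: H) ->
    H \subset component (X :\ v) h ->
  #|rooted H (component (X :\ v) h)| * #|X :\: component (X :\ v) h|
    <= #|rooted (v |: H) X|.
Proof.
move=> cX hH vX cvH sHC; set C := component _ _.
have hX : h \in X :\ v.
  exact: (subsetP (component_sub _ _)) (subsetP sHC h hH).
have vXC : v \in X :\: C.
  by rewrite inE vX andbT; apply/negP=> /(subsetP (component_sub _ _)); rewrite setD11.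
have sCX : C \subset X := subset_trans (component_sub _ _) (subD1set _ _).
have cXC := connected_setD_component cX vX hX.
apply: leq_trans (leq_mul (leqnn _) (leq_card_rooted cXC vXC)) _.
rewrite -cardsX; pose f (p : {set G} * {set G}) := p.1 :|: p.2.
rewrite -(@card_in_imset _ _ f) => [|[U B] [U' B']]; last first.
  have trace W (D : {set G}) : W \subset C -> D \subset X :\: C ->
      ((W :|: D) :&: C = W) * ((W :|: D) :\: C = D).
    rewrite subsetD => sWC /andP[_ dDC]; split.
      by rewrite setIUl (setIidPl sWC) (disjoint_setI0 dDC) setU0.
    move: sWC; rewrite -setD_eq0 setDUl => /eqP ->; rewrite set0U.
    by apply/setDidPl.
  rewrite !inE /= -!andbA => /and5P[_ _ sU _ /andP[_ sB]].
  move=> /and5P[_ _ sU' _ /andP[_ sB']]; rewrite /f /= => eqf.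
  have [UE BE] := trace _ _ sU sB; have [UE' BE'] := trace _ _ sU' sB'.
  by congr (_, _); [rewrite -UE -UE' eqf | rewrite -BE -BE' eqf].
apply/subset_leq_card/subsetP=> _ /imsetP[[U B] /setXP[/= UH BvX] ->].
have [cU sHU sUC] := rootedP _ _ _ UH; have [cB vB sB] := rootedP _ _ _ BvX.
rewrite sub1set in vB; rewrite /f /=; apply/rootedP; split.
(* Inserting [v |: H] changes nothing, as [H] lies in [U] and [v] in [B], but it splits the gluing
   into one at [h] and one at [v]. *)
- have -> : U :|: B = U :|: (v |: H) :|: B.
    apply/setP=> z; rewrite !inE; have := subsetP sHU z.
    case: (z \in H) => [-> // | _]; case: eqP => [-> | _].
      by rewrite vB !orbT.
    by rewrite !orbF.
  apply: (@connected_setU _ _ _ v) => //; last by rewrite !inE eqxx orbT.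
  apply: (@connected_setU _ _ _ h) => //; first exact: (subsetP sHU).
  by rewrite inE hH orbT.
- by rewrite subUset sub1set inE vB orbT (subset_trans sHU) ?subsetUl.
- rewrite subUset (subset_trans sUC) //=; exact: subset_trans sB (subsetDl _ _).
Qed.

(* Peel off a neighbour v of H: connected sets avoiding v live in the component
   X1 of H in X - v, and each of them extends through v in at least |X \ X1|
   ways, which pays for the drop from |X| to |X1|. *)
Lemma rooted_average H X : connected_set H -> H != set0 ->
    connected_set X -> H \subset X ->
  (#|X| + #|H|) * #|rooted H X| <= 2 * \sum_(U in rooted H X) #|U|.
Proof.
have [k] := ubnP (#|X| - #|H|); elim: k H X => // k IHk H X lt_k cH H0 cX sHX.
have [eqHX | neHX] := eqVneq H X.
  have -> : rooted H X = [set X].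
    apply/setP=> U; rewrite eqHX !inE -andbA -eqEsubset [X == U]eq_sym.
    by case: eqP => [->|]; rewrite ?cX ?andbF.
  by rewrite cards1 big_set1 eqHX; lia.
have [|_ [z zX zNH]] := properP (_ : H \proper X).
  by rewrite properEneq neHX.
have [h hH] := set0Pn _ H0.
have [v] := connected_set_grow cX sHX cH hH zX zNH.
rewrite inE => /andP[vNH vX] cvH.
have sHXv : H \subset X :\ v by rewrite subsetD1 sHX.
pose C := component (X :\ v) h.
have hXv := subsetP sHXv h hH.
have sHC : H \subset C by apply: component_max (component_id hXv).
have cC : connected_set C by apply: component_connected.
have svHX : v |: H \subset X by rewrite subUset sub1set vX.
have cardvH : #|v |: H| = #|H|.+1 by rewrite cardsU1 vNH.
have ltCX : #|C| < #|X|.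
  apply: proper_card; apply: sub_proper_trans (component_sub _ _) _.
  exact: properD1.
have leHC : #|H| <= #|C| by apply: subset_leq_card.
have le_vH := IHk (v |: H) X _ cvH _ cX svHX.
have le_C := IHk H C _ cH H0 cC sHC.
have le_CX := leq_card_rooted_setU1 cX hH vX cvH sHC.
have sCX : C \subset X := subset_trans (component_sub _ _) (subD1set _ _).
move: le_CX; rewrite cardsDS // -/C => le_CX.
have card_split : #|rooted H X| = #|rooted (v |: H) X| + #|rooted H C|.
  by rewrite -!sum1_card (big_rooted_split _ hH sHXv).
rewrite card_split (big_rooted_split _ hH sHXv) -/C.
have {}le_vH : (#|X| + #|H|.+1) * #|rooted (v |: H) X|
      <= 2 * \sum_(U in rooted (v |: H) X) #|U|.
  rewrite -cardvH; apply: le_vH.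
    by rewrite cardvH; clear -leHC ltCX lt_k; lia.
  by apply/set0Pn; exists v; rewrite setU11.
have {}le_C : (#|C| + #|H|) * #|rooted H C| <= 2 * \sum_(U in rooted H C) #|U|.
  by apply: le_C; clear -leHC ltCX lt_k; lia.
move: le_CX le_vH le_C; have -> : #|X| = #|C| + (#|X| - #|C|) by rewrite subnKC // ltnW.
rewrite addKn.
move: (#|X| - #|C|) (#|rooted H C|) (#|rooted (v |: H) X|) (#|C|) (#|H|) => d a b c h'.
move: (\sum_(U in rooted H C) _) (\sum_(U in rooted _ X) _) => sa sb.
clear; rewrite !mulnDr !mulnDl; lia.
Qed.

End RootedAverage.

(** * An inequality between sums and products *)

Section ProductBounds.
Variables (I : finType) (J : {set I}) (a g T : I -> nat).
(** In the application [J] is the set of components of [G - v], [a] gives their orders,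
    [1 + a i + g i] counts the connected sets through [v] in the component plus [v], and [T] those
    inside it. Then [M] is [#|G|.-1] and [s i] is [#|G| - a i]. *)
Let M := \sum_(i in J) a i.
Let s i := 1 + M - a i.

Lemma leq_sum_prod (r : seq I) (P : pred I) :
  1 + \sum_(i <- r | P i) a i <= \prod_(i <- r | P i) (1 + a i).
Proof.
elim: r => [|x r IHr]; first by rewrite !big_nil.
rewrite !big_cons; case: (P x) => //; move: IHr.
by move: (\sum_(i <- _ | _) _) (\prod_(i <- _ | _) _) => b p; nia.
Qed.

(** Expand the right side in the [g i], keeping constant and linear terms; the coefficient of [g i]
    is the product of the other [1 + a j], bounded below as in [leq_sum_prod]. *)
Lemma leq_sum_prodD (r : seq I) (P : pred I) :
  \prod_(i <- r | P i) (1 + a i)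
    + \sum_(i <- r | P i) g i * (1 + \sum_(j <- r | P j) a j - a i)
  <= \prod_(i <- r | P i) (1 + a i + g i).
Proof.
elim: r => [|x r IHr]; first by rewrite !big_nil.
rewrite !big_cons; case: ifP => // Px.
have := leq_sum_prod r P; move: IHr.
set b := \sum_(i <- r | P i) a i; set p := \prod_(i <- r | P i) (1 + a i).
set c := \sum_(i <- r | P i) g i * (1 + b - a i).
set d := \sum_(i <- r | P i) g i * _; set q := \prod_(i <- r | P i) _ => le_q le_p.
(* A new index [x] adds only [a x] to each weight [1 + b - a i], which is positive since [a i <= b];
   so the factor [1 + a x] dominates. *)
have le_d : d <= (1 + a x) * c.
  rewrite /d /c big_distrr /= big_seq_cond [leqRHS]big_seq_cond; apply: leq_sum => i /andP[ir Pi].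
  have : a i <= b.
    rewrite /b (big_rem i ir) /= Pi; exact: leq_addr.
  by clear -i; move: (a i) (a x) b (g i) => ai ax b' gi; nia.
have -> : 1 + (a x + b) - a x = 1 + b by lia.
by clear -le_q le_p le_d; move: (a x) (g x) le_d => ax gx; nia.
Qed.

Lemma leq_term_prod i : i \in J -> (1 + a i) * s i <= \prod_(j in J) (1 + a j).
Proof.
move=> iJ; rewrite /s /M (bigD1 i iJ) [in leqRHS](bigD1 i iJ) /= addnCA addKn.
by rewrite leq_mul2l leq_sum_prod orbT.
Qed.

(** Two further positive indices [j] and [k] contribute the cross term [a j * a k], absent on the
    left. This rules out three components in the equality case. *)
Lemma ltn_term_prod i : i \in J -> (forall j, j \in J -> 0 < a j) -> 2 < #|J| ->
  (1 + a i) * s i < \prod_(j in J) (1 + a j).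
Proof.
move=> iJ a_gt0 J_gt2; rewrite /s /M (bigD1 i iJ) [in ltnRHS](bigD1 i iJ) /=.
rewrite addnCA addKn ltn_mul2l /=.
have [j jJi] : exists j, j \in J :\ i.
  by apply/set0Pn; rewrite -card_gt0; move: (cardsD1 i J); rewrite iJ; lia.
have [k kJij] : exists k, k \in J :\ i :\ j.
  apply/set0Pn; rewrite -card_gt0.
  by move: (cardsD1 i J) (cardsD1 j (J :\ i)); rewrite iJ jJi; lia.
move: jJi kJij; rewrite !inE => /andP[ne_ji jJ] /and3P[ne_kj ne_ki kJ].
have Pj : (j \in J) && (j != i) by rewrite jJ.
rewrite (bigD1 j Pj) [in ltnRHS](bigD1 j Pj) /=.
set b := \sum_(_ | _) _; set p := \prod_(_ | _) _.
have le_p : 1 + b <= p by apply: leq_sum_prod.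
have b_gt0 : 0 < b.
  have Pk : (k \in J) && (k != i) && (k != j) by rewrite kJ ne_ki.
  rewrite /b (bigD1 k Pk) /=.
  exact: leq_trans (a_gt0 k kJ) (leq_addr _ _).
by have := a_gt0 j jJ; clear -le_p b_gt0; move: (a j) => aj; nia.
Qed.

Hypothesis leT : forall i, i \in J -> 2 * T i <= a i * (1 + a i) + M * g i.

(** Three estimates are chained: [leT], then [leq_term_prod] weighted by [a i] and summed to [M],
    then [leq_sum_prodD]. The [?= iff] form records equality in each of them. *)
Lemma leq_weighted_sum :
  2 * \sum_(i in J) T i * s i <= M * \prod_(i in J) (1 + a i + g i)
    ?= iff [forall (i | i \in J), 2 * T i == a i * (1 + a i) + M * g i]
        && [forall (i | i \in J), a i * ((1 + a i) * s i) == a i * \prod_(j in J) (1 + a j)]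
        && (M * (\prod_(i in J) (1 + a i) + \sum_(i in J) g i * s i)
            == M * \prod_(i in J) (1 + a i + g i)).
Proof.
have s_gt0 i : i \in J -> 0 < s i.
  by move=> iJ; rewrite /s /M (bigD1 i iJ) /=; lia.
have step1 : 2 * \sum_(i in J) T i * s i
    <= \sum_(i in J) (a i * (1 + a i) + M * g i) * s i
    ?= iff [forall (i | i \in J), 2 * T i == a i * (1 + a i) + M * g i].
  rewrite big_distrr /=; apply: leqif_sum => i iJ; split.
    by rewrite mulnA leq_mul2r leT ?orbT.
  by rewrite mulnA eqn_pmul2r ?s_gt0.
have step2 : \sum_(i in J) a i * ((1 + a i) * s i)
    <= \sum_(i in J) a i * \prod_(j in J) (1 + a j)
    ?= iff [forall (i | i \in J), a i * ((1 + a i) * s i) == a i * \prod_(j in J) (1 + a j)].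
  apply: leqif_sum => i iJ; split=> //.
  by rewrite leq_mul2l leq_term_prod ?orbT.
have step3 : M * (\prod_(i in J) (1 + a i) + \sum_(i in J) g i * s i)
    <= M * \prod_(i in J) (1 + a i + g i)
    ?= iff (M * (\prod_(i in J) (1 + a i) + \sum_(i in J) g i * s i)
            == M * \prod_(i in J) (1 + a i + g i)).
  by split=> //; rewrite leq_mul2l leq_sum_prodD orbT.
have {}step2 : \sum_(i in J) (a i * (1 + a i) + M * g i) * s i
    <= M * (\prod_(i in J) (1 + a i) + \sum_(i in J) g i * s i)
    ?= iff [forall (i | i \in J), a i * ((1 + a i) * s i) == a i * \prod_(j in J) (1 + a j)].
  rewrite mulnDr {1}/M big_distrl big_distrr /=.
  under eq_bigr do rewrite mulnDl -!mulnA.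
  rewrite big_split /=.
  by case: step2 => le2 <-; split; rewrite ?leq_add2r ?eqn_add2r.
exact: leqif_trans (leqif_trans step1 step2) step3.
Qed.

End ProductBounds.

(** * Connected sets under embeddings and vertex deletion *)

Section Embedding.
Variables (G H : sgraph) (f : G -> H).
Hypotheses (inj_f : injective f) (edge_f : forall x y, edge (f x) (f y) = edge x y).

Lemma connected_set_imset (U : {set G}) :
  connected_set (f @: U) = connected_set U.
Proof.
apply/connected_setP/connected_setP => cU A x y sAU xA yU yNA.
  have [||||_ [_ [/imsetP[a aA ->] /imsetP[b bU ->]]]] := cU (f @: A) (f x) (f y).
  - exact: imsetS.
  - exact: imset_f.
  - exact: imset_f.
  - by rewrite mem_imset.
  by rewrite mem_imset // edge_f => bNA ab; exists a, b.
have /imsetP[x' x'U def_x] := subsetP sAU x xA; have /imsetP[y' y'U def_y] := yU.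
have [||||a [b []]] := cU (f @^-1: A) x' y'.
- apply/subsetP=> z; rewrite inE => /(subsetP sAU)/imsetP[t tU].
  by move/inj_f->.
- by rewrite inE -def_x.
- by [].
- by rewrite inE -def_y.
rewrite !inE => aA bU bNA ab.
by exists (f a), (f b); rewrite edge_f imset_f.
Qed.

(** A general [phi] treats the number of connected sets and their total size at once; the lemma
    serves both induced subgraphs and isomorphisms. *)
Lemma big_conn_sets_imset (phi : nat -> nat) :
  \sum_(U in conn_sets H | U \subset f @: [set: G]) phi #|U|
    = \sum_(U in conn_sets G) phi #|U|.
Proof.
rewrite -[RHS](eq_bigr _ (fun U _ => congr1 phi (card_imset _ inj_f))).
rewrite -[RHS](big_imset (h := fun U : {set G} => f @: U) (fun U => phi #|U|)) /=;
  last first.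
  by move=> U W _ _; apply: (imset_inj inj_f).
apply: eq_bigl => U; apply/andP/imsetP => [[] | [W]].
  rewrite inE => /andP[U0 cU] sU.
  have def_U : U = f @: (f @^-1: U).
    apply/setP=> y; apply/idP/imsetP => [yU | [x xU ->]].
      by have /imsetP[x _ def_y] := subsetP sU y yU; exists x; rewrite ?inE -?def_y.
    by rewrite inE in xU.
  exists (f @^-1: U); rewrite // inE -connected_set_imset -def_U cU andbT.
  by apply: contraNneq U0 => U0; rewrite def_U U0 imset0.
rewrite inE => /andP[W0 cW] ->; rewrite inE connected_set_imset cW andbT.
by rewrite imset_eq0 W0 imsetS ?subsetT.
Qed.

End Embedding.

(** * Components of [G - v] and the connected sets inside them *)

Section Components.
Variable G : sgraph.
Implicit Types (A B C H U W X Y : {set G}) (x y v : G).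

Definition subconn X : {set {set G}} := [set U in conn_sets G | U \subset X].

Lemma big_subconn_induced X (phi : nat -> nat) :
  \sum_(U in subconn X) phi #|U| = \sum_(U in conn_sets (induced X)) phi #|U|.
Proof.
have defX : [set val x | x in [set: induced X]] = X.
  apply/setP=> x; apply/imsetP/idP => [[y _ ->] | xX]; first exact: valP.
  by exists (Sub x xX).
rewrite -(@big_conn_sets_imset (induced X) G val val_inj) //.
by apply: eq_bigl => U; rewrite [LHS]inE -{1}defX.
Qed.

Lemma num_conn_induced X : num_conn (induced X) = #|subconn X|.
Proof.
by rewrite /num_conn -!sum1_card; apply/esym/(big_subconn_induced X (fun=> 1)).
Qed.

Lemma sum_conn_induced X : sum_conn (induced X) = \sum_(U in subconn X) #|U|.
Proof. exact/esym/(big_subconn_induced X id). Qed.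

Definition components v : {set {set G}} :=
  [set component (~: [set v]) x | x in ~: [set v]].

Lemma componentsP v C : C \in components v ->
  exists2 x, x != v & C = component (~: [set v]) x.
Proof. by case/imsetP=> x; rewrite !inE => xv ->; exists x. Qed.

Lemma mem_component v x : x != v -> x \in component (~: [set v]) x.
Proof. by move=> xv; rewrite component_id // !inE. Qed.

Lemma component_components v x : x != v ->
  component (~: [set v]) x \in components v.
Proof. by move=> xv; rewrite imset_f ?inE. Qed.

Lemma components_eq v x C : C \in components v -> x \in C ->
  (x != v) * (C = component (~: [set v]) x).
Proof.
case/componentsP=> y yv -> xC; have := subsetP (component_sub _ _) x xC.
by rewrite !inE => xv; split=> //; rewrite (component_eq _ xC) ?inE.
Qed.

Lemma components_connected v C : C \in components v -> connected_set C.
Proof. by case/componentsP=> x xv ->; apply: component_connected; rewrite !inE. Qed.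

Lemma components_notin v C : C \in components v -> v \notin C.
Proof.
by move=> CP; apply/negP=> vC; have [] := components_eq CP vC; rewrite eqxx.
Qed.

Lemma components_edge v C x y : C \in components v -> x \in C -> edge x y ->
  y \in v |: C.
Proof.
move=> CP xC xy; rewrite !inE; case: eqVneq => //= yv.
have [_ ->] := components_eq CP xC.
by apply: (component_edge (mem_component (components_eq CP xC).1)) xy; rewrite !inE.
Qed.

Lemma trivIset_components v : trivIset (components v).
Proof.
apply/trivIsetP=> C D CP DP; apply: contraR => /pred0Pn[x /andP[/= xC xD]].
by rewrite (components_eq CP xC).2 (components_eq DP xD).2.
Qed.

Lemma cover_components v : cover (components v) = ~: [set v].
Proof.
apply/setP=> x; rewrite !inE; apply/bigcupP/idP => [[C CP xC] | xv].
  exact: (components_eq CP xC).1.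
by exists (component (~: [set v]) x); [exact: component_components | exact: mem_component].
Qed.

Lemma sum_card_components v : \sum_(C in components v) #|C| = #|G|.-1.
Proof.
by rewrite (eqP (trivIset_components v)) cover_components cardsC1.
Qed.

Lemma big_conn_sets_split v (phi : {set G} -> nat) :
  \sum_(U in conn_sets G) phi U = \sum_(U in rooted [set v] [set: G]) phi U
    + \sum_(C in components v) \sum_(U in subconn C) phi U.
Proof.
rewrite (bigID (fun U => v \in U)) /=; congr (_ + _).
  apply: eq_bigl => U; rewrite !inE sub1set subsetT andbT.
  case vU: (v \in U); rewrite ?andbF ?andbT //=.
  by have -> : U != set0 by apply/set0Pn; exists v.
(* The component containing [U]; the default [set0] never occurs for a nonempty connected [U]
   avoiding [v]. *)
pose p U : {set G} := odflt set0 [pick C in components v | U \subset C].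
have pE U C : C \in components v -> U != set0 -> U \subset C -> p U = C.
  move=> CP /set0Pn[x xU] sUC; rewrite /p; case: pickP => [D /andP[DP sUD] | /(_ C)].
    rewrite (components_eq DP (subsetP sUD x xU)).2.
    by rewrite (components_eq CP (subsetP sUC x xU)).2.
  by rewrite CP sUC.
have pP U : U \in conn_sets G -> v \notin U -> p U \in components v /\ U \subset p U.
  rewrite inE => /andP[U0 cU] vU; have [x xU] := set0Pn _ U0.
  have xv : x != v by apply: contraNneq vU => <-.
  have sU : U \subset component (~: [set v]) x.
    apply: component_max cU _ xU (mem_component xv).
    by rewrite subsetC sub1set inE.
  by rewrite (pE _ _ (component_components xv) U0 sU) component_components.
rewrite (partition_big p (fun C => C \in components v)) => [|U /andP[UP vU]]; last first.
  by have [] := pP U UP vU.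
apply: eq_bigr => C CP; apply: eq_bigl => U; rewrite [RHS]inE.
apply/andP/andP => [[/andP[UP vU] /eqP <-] | [UP sUC]].
  by split=> //; have [] := pP U UP vU.
split; last by apply/eqP/pE => //; move: UP; rewrite inE => /andP[].
by rewrite UP (contra (subsetP sUC v)) ?components_notin.
Qed.

Lemma connected_setU1_bigcup v (J : {set {set G}}) (f : {set G} -> {set G}) :
    (forall C, C \in J -> connected_set (f C) && (v \in f C)) ->
  connected_set (v |: \bigcup_(C in J) f C).
Proof.
move=> cf; pose Q X := connected_set (v |: X).
apply: (@big_ind _ Q) => [|X Y QX QY|C /cf/andP[cC vC]].
- by rewrite /Q setU0 connected_set1.
- by rewrite /Q setUUr (@connected_setU _ _ _ v) ?setU11.
- by rewrite /Q (setUidPr _) // sub1set.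
Qed.

(** Choose in every [v |: C] a connected set through [v]: the union is again connected through [v],
    and intersecting it with [v |: C] recovers each choice. *)
Lemma leq_prod_card_rooted v :
  \prod_(C in components v) #|rooted [set v] (v |: C)|
    <= #|rooted [set v] [set: G]|.
Proof.
pose F (C : {set G}) := rooted [set v] (v |: C).
(* Functions are fixed to [set0] off the components, so that each family of choices is counted
   once. *)
pose fam := pfamily set0 (mem (components v)) (fun C => mem (F C)).
pose h (f : {ffun {set G} -> {set G}}) := v |: \bigcup_(C in components v) f C.
have famP f C : f \in fam -> C \in components v ->
    [/\ connected_set (f C), v \in f C & f C \subset v |: C].
  move=> /pfamilyP[_ fF] CP; have /rootedP[? sv ?] := fF C CP.
  by rewrite -sub1set.
have hK f C : f \in fam -> C \in components v -> h f :&: (v |: C) = f C.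
  move=> fP CP; have [_ vf sf] := famP f C fP CP.
  apply/setP=> x; rewrite in_setI /h !in_setU1; case: (eqVneq x v) => [-> | xv] /=.
    by rewrite vf.
  apply/andP/idP => [[/bigcupP[D DP xD] xC] | xf]; last first.
    split; first by apply/bigcupP; exists C.
    by have := subsetP sf x xf; rewrite !inE (negPf xv).
  have [_ _ sfD] := famP f D fP DP.
  have := subsetP sfD x xD; rewrite !inE (negPf xv) /= => xDD.
  by rewrite (components_eq CP xC).2 -(components_eq DP xDD).2.
have <- : #|fam| = \prod_(C in components v) #|F C|.
  rewrite /fam card_pfamily foldrE big_map big_enum /=.
  by apply: eq_bigr.
rewrite -(@card_in_imset _ _ h) => [|f1 f2 f1P f2P eqh]; last first.
  apply/ffunP=> C; case CP: (C \in components v).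
    by rewrite -(hK f1) // eqh hK.
  have out f : f \in fam -> f C = set0.
    case/pfamilyP=> /supportP sf _; apply: sf.
    by apply/negbT.
  by rewrite !out.
apply/subset_leq_card/subsetP=> _ /imsetP[f fP ->]; apply/rootedP.
split; rewrite ?subsetT ?sub1set ?setU11 //.
by apply: connected_setU1_bigcup => C CP; have [-> -> _] := famP f C fP CP.
Qed.

End Components.

(** * Distance and eccentricity *)

Section Distance.
Variable G : sgraph.
Implicit Types (C U W : {set G}) (x y z u v w : G).

Fixpoint reach k x y : bool :=
  if k is k'.+1 then [exists z, reach k' x z && edge z y] else x == y.

Lemma reachD j k x y :
  reach (j + k) x y = [exists z, reach j x z && reach k z y].
Proof.
elim: k y => [|k IHk] y.
  rewrite addn0; apply/idP/existsP => [xy | [z /andP[xz /eqP <-]] //].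
  by exists y; rewrite xy /=.
rewrite addnS /=; apply/existsP/existsP => [[t /andP[]] | [z /andP[xz /existsP[t]]]].
  rewrite IHk => /existsP[z /andP[xz zt]] ty; exists z; rewrite xz /=.
  by apply/existsP; exists t; rewrite zt.
case/andP=> zt ty; exists t; rewrite IHk ty andbT.
by apply/existsP; exists z; rewrite xz.
Qed.

Lemma reach1 x y : reach 1 x y = edge x y.
Proof.
by apply/existsP/idP => [[z /andP[/= /eqP ->]] | xy] //; exists x; rewrite /= eqxx.
Qed.

Lemma reach_sym k x y : reach k x y = reach k y x.
Proof.
elim: k x y => [|k IHk] x y; first exact: eq_sym.
rewrite -[in RHS]add1n reachD /=.
by apply: eq_existsb => z; rewrite -/(reach 1 y z) reach1 andbC IHk edge_sym.
Qed.

Lemma reach_leave C k x y : reach k x y -> x \in C -> y \notin C ->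
  exists a b, [/\ a \in C, b \notin C & edge a b].
Proof.
elim: k y => [|k IHk] y /=; first by move=> /eqP -> ->.
case/existsP=> z /andP[xz zy] xC yC.
by have [zC | zNC] := boolP (z \in C); [exists z, y | apply: IHk xz _ _].
Qed.

(** A walk leaving [C] must pass through [v], the only possible neighbour of [C] outside [C]; [i] is
    the step at which it does. *)
Lemma reach_cut v C k x y : C \in components v -> reach k x y ->
    x \in C -> y \notin C ->
  exists i, [/\ i <= k, reach i x v & reach (k - i) v y].
Proof.
move=> CP; elim: k y => [|k IHk] y /=; first by move=> /eqP -> ->.
case/existsP=> z /andP[xz zy] xC yC; have [zC | zNC] := boolP (z \in C).
  have := components_edge CP zC zy; rewrite in_setU1 (negPf yC) orbF => /eqP yv.
  exists k.+1; rewrite subnn /= yv eqxx; split=> //.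
  by apply/existsP; exists z; rewrite xz -yv.
have [i [le_ik xv vz]] := IHk z xz xC zNC.
exists i; rewrite ltnW // subSn //=; split=> //.
by apply/existsP; exists z; rewrite vz.
Qed.

Hypothesis conn_G : connected G.

Lemma reach_ex x y : exists k, reach k x y.
Proof.
have /forallP/(_ x)/forallP/(_ y)/connectP[p] := conn_G.
elim/last_ind: p y => [|p z IHp] y; first by move=> _ ->; exists 0; rewrite /= eqxx.
rewrite rcons_path last_rcons => /andP[xp pz] ->.
have [k xk] := IHp _ xp erefl; exists k.+1 => /=.
by apply/existsP; exists (last x p); rewrite xk.
Qed.

Definition dist x y := ex_minn (reach_ex x y).

Lemma distP x y : reach (dist x y) x y.
Proof. by rewrite /dist; case: ex_minnP. Qed.

Lemma dist_min k x y : reach k x y -> dist x y <= k.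
Proof. by rewrite /dist; case: ex_minnP => m _ le_m /le_m. Qed.

Lemma dist_sym x y : dist x y = dist y x.
Proof.
by apply/eqP; rewrite eqn_leq !dist_min // reach_sym distP.
Qed.

Lemma dist_triangle z x y : dist x y <= dist x z + dist z y.
Proof. by apply: dist_min; rewrite reachD; apply/existsP; exists z; rewrite !distP. Qed.

Lemma distxx x : dist x x = 0.
Proof. by apply/eqP; rewrite -leqn0 dist_min /=. Qed.

Lemma dist_eq0 x y : (dist x y == 0) = (x == y).
Proof.
apply/eqP/eqP => [xy0 | ->]; last exact: distxx.
by have := distP x y; rewrite xy0 => /eqP.
Qed.

Lemma dist_edge v x y : edge x y -> dist v y <= (dist v x).+1.
Proof.
by move=> xy; rewrite dist_min //=; apply/existsP; exists x; rewrite distP.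
Qed.

Lemma dist_between i x y : i <= dist x y ->
  exists2 u, dist x u = i & dist u y = dist x y - i.
Proof.
move=> le_i; have := distP x y; rewrite -{1}(subnKC le_i) reachD.
case/existsP=> u /andP[/dist_min le_xu /dist_min le_uy].
by exists u; have := dist_triangle u x y; lia.
Qed.

Lemma dist1_edge x y : dist x y = 1 -> edge x y.
Proof. by move=> xy1; have := distP x y; rewrite xy1 reach1. Qed.

Lemma dist_cut v C x y : C \in components v -> x \in C -> y \notin C ->
  dist x y = dist x v + dist v y.
Proof.
move=> CP xC yC; apply/eqP; rewrite eqn_leq dist_triangle /=.
have [i [le_i /dist_min xv /dist_min vy]] := reach_cut CP (distP x y) xC yC.
lia.
Qed.

Lemma connected_setT : connected_set [set: G].
Proof.
apply/connected_setP=> A x y _ xA _ yNA.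
have [a [b [aA bNA ab]]] := reach_leave (distP x y) xA yNA.
by exists a, b; rewrite inE.
Qed.

Definition interval x y : {set G} := [set u | dist x u + dist u y == dist x y].

Lemma intervalP x y u :
  reflect (dist x u + dist u y = dist x y) (u \in interval x y).
Proof. by rewrite inE; apply: eqP. Qed.

Lemma leq_card_interval x y : dist x y < #|interval x y|.
Proof.
have /fin_all_exists2[f fx fy] (i : 'I_(dist x y).+1) :
    exists2 u, dist x u = i & dist u y = dist x y - i.
  by apply: dist_between; rewrite -ltnS.
have inj_f : injective f.
  by move=> i j eqf; apply: val_inj; rewrite /= -!fx eqf.
apply: (@leq_trans #|f @: [set: 'I_(dist x y).+1]|).
  by rewrite card_imset // cardsT card_ord.
apply/subset_leq_card/subsetP=> _ /imsetP[i _ ->].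
by rewrite inE fx fy subnKC // -ltnS.
Qed.

Lemma card_gt_dist x y : dist x y < #|G|.
Proof. exact: leq_trans (leq_card_interval x y) (max_card _). Qed.

Definition ecc v := \max_(x : G) dist v x.

Lemma dist_ecc v x : dist v x <= ecc v.
Proof. exact: leq_bigmax. Qed.

Lemma ecc_attained v : exists x, dist v x = ecc v.
Proof.
have /(@bigop.eq_bigmax G (dist v))[x def_e] : 0 < #|G| by apply/card_gt0P; exists v.
by exists x.
Qed.

(* Let v have least eccentricity e, attained at w, and let p follow v on a
   geodesic to w.  Some z has dist p z >= e, and then the geodesic from v to z
   misses the one from p to w; together they have at least 2e vertices. *)
Lemma central_vertex : 0 < #|G| -> exists v, (ecc v).*2 < #|G| \/
  exists w z, [/\ #|G| = (ecc v).*2, dist v w = ecc v, dist v z = (ecc v).-1,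
    forall x, dist v x = ecc v -> x = w
    & forall x, x != v -> dist x w < ecc v \/ dist v x + dist x z = dist v z].
Proof.
case/card_gt0P=> v0 _.
have [v _ min_v] := @arg_minnP G v0 predT ecc isT; exists v.
set e := ecc v in min_v *.
have [e0 | e_gt0] := posnP e.
  by left; rewrite e0; apply/card_gt0P; exists v.
have [w dvw] := ecc_attained v; rewrite -/e in dvw.
have [|p dvp dpw] := @dist_between 1 v w; first by rewrite dvw.
have [z dpz] := ecc_attained p.
have le_epz : e <= dist p z by rewrite dpz min_v.
have le_zv : dist v z <= e := dist_ecc v z.
have le_pz : dist p z <= 1 + dist v z.
  by rewrite -dvp [dist v p]dist_sym dist_triangle.
(* For a common vertex [x], the triangle inequalities from [p] to [z] and from [v] to [w] through
   [x] add up to [2e <= (e - 1) + dist v z <= 2e - 1]. *)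
have disj : [disjoint interval p w & interval v z].
  apply/pred0Pn => -[x /andP[/= /intervalP xpw /intervalP xvz]].
  have := dist_triangle x p z; have := dist_triangle x v w.
  lia.
have cardU : #|interval p w :|: interval v z| = #|interval p w| + #|interval v z|.
  by rewrite cardsU (disjoint_setI0 disj) cards0 subn0.
have := leq_card_interval p w; have := leq_card_interval v z.
have := max_card (mem (interval p w :|: interval v z)); rewrite cardU => leU lez lew.
have [lt_e | le_n] := ltnP e.*2 #|G|; [by left | right].
exists w, z.
(* Each interval has at least [e] vertices and [#|G| <= e.*2], so both have exactly [e] and together
   they cover [G]. *)
have cardG : #|G| = e.*2 by lia.
have dvz : dist v z = e.-1 by lia.
have inU x : (x \in interval p w) || (x \in interval v z).
  have : interval p w :|: interval v z == [set: G].
    by rewrite eqEcard subsetT cardsT cardU; lia.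
  by move/eqP/setP/(_ x); rewrite !inE.
split=> // x => [dvx | _].
  case/orP: (inU x) => /intervalP xI; last by lia.
  apply/eqP; rewrite -dist_eq0.
  by have := dist_triangle p v x; lia.
by case/orP: (inU x) => /intervalP xI; [left; lia | right].
Qed.

End Distance.

(** Sum [minn j e = j - (j - e)] with truncated subtraction. The correction stands on the left to
    keep the identity additive, and vanishes when [m <= e]. *)
Lemma sum_minn m e :
  2 * \sum_(j < m.+1) minn j e + (m - e) * (m - e).+1 = m * m.+1.
Proof.
elim: m => [|m IHm]; first by rewrite big_ord1 min0n.
rewrite big_ord_recr /=; have [le_em | lt_me] := leqP e m.
  by move: IHm; rewrite subSn //; move: (\sum_(j < _) _) => s; nia.
by move: IHm; move: (\sum_(j < _) _) => s; nia.
Qed.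

(** * Counting connected sets avoiding a vertex *)

Section ComponentBounds.
Variable G : sgraph.
Hypothesis conn_G : connected G.
Variables (v : G) (C : {set G}).
Hypothesis compC : C \in components v.
Implicit Types (U W P : {set G}) (x y z u w : G).
Let dist := dist conn_G.
Let F := rooted [set v] (v |: C).

Lemma connected_root_component : connected_set (v |: C).
Proof.
have [x xv def_C] := componentsP compC.
have xC : x \in C by rewrite def_C mem_component.
have [a [b [aC bNC ab]]] :=
  reach_leave (distP conn_G x v) xC (components_notin compC).
have := components_edge compC aC ab; rewrite in_setU1 (negPf bNC) orbF => /eqP bv.
by rewrite -bv; apply: connected_setU1 ab => //; apply: components_connected compC.
Qed.

(** A shortest walk traced back from [u] stays in [v |: C], because edges out of [C] lead to [v].
    Since [u] is the only farthest vertex of [P], cutting by distance can remove all of [P] but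
    [u]. *)
Lemma geodesic u : u \in v |: C -> exists P,
  [/\ connected_set P, v \in P, P \subset v |: C, u \in P
    & #|P| = (dist v u).+1 /\ forall x, x \in P -> x != u -> dist v x < dist v u].
Proof.
move Dk: (dist v u) => k; elim: k u Dk => [|k IHk] u Dk uC.
  have /eqP <- : v == u by rewrite -(dist_eq0 conn_G) -/dist Dk.
  exists [set v]; rewrite connected_set1 sub1set set11 setU11 cards1.
  by split=> //; split=> // x /set1P->; rewrite eqxx.
have [|t dvt] := @dist_between G conn_G k v u; first by rewrite -/dist Dk.
rewrite -/dist Dk subSnn => /dist1_edge tu.
have {uC} uC : u \in C.
  by case/setU1P: uC => // uv; move: Dk; rewrite uv /dist distxx.
have tC : t \in v |: C by apply: (components_edge compC uC); rewrite edge_sym.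
have [P [cP vP sP tP [cardP ltP]]] := IHk t dvt tC.
have le_P x : x \in P -> dist v x <= k.
  by move=> xP; have [-> | xt] := eqVneq x t; [rewrite /dist dvt | rewrite ltnW ?ltP].
have uNP : u \notin P by apply/negP=> /le_P; rewrite Dk ltnn.
exists (u |: P); split; rewrite ?setU11 ?(connected_setU1 cP tP tu) //.
- by rewrite !inE vP orbT.
- by rewrite subUset sub1set !inE uC orbT.
split; first by rewrite cardsU1 uNP cardP.
by move=> x /setU1P[-> | xP _]; [rewrite eqxx | rewrite ltnS le_P].
Qed.

(* U is recovered from its union W with a geodesic of length k = dist v U by
   cutting W at distance k. *)
Lemma leq_card_near_subconn e :
  #|[set U in subconn C | [exists u in U, dist v u <= e]]|
    <= \sum_(W in F) minn #|W|.-1 e.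
Proof.
pose b W := minn #|W|.-1 e.
(* The index stores [k - 1], where [k] is the distance from [v] to the set; as [k >= 1], the bound
   [k <= b W] becomes [p.2 < b p.1]. *)
pose Q := [set p : {set G} * 'I_#|G| | (p.1 \in F) && (p.2 < b p.1)].
pose trunc (p : {set G} * 'I_#|G|) := [set x in p.1 | p.2 < dist v x].
have cardQ : #|Q| = \sum_(W in F) b W.
  rewrite -sum1_card (eq_bigl (fun p : {set G} * 'I_#|G| =>
      (p.1 \in F) && (p.2 < b p.1))); last first.
    by move=> p; rewrite inE.
  rewrite -(pair_big_dep (fun W => W \in F) (fun W (i : 'I_#|G|) => i < b W) (fun _ _ => 1)) /=.
  apply: eq_bigr => W _; have le_b : b W <= #|G|.
    rewrite /b; apply: leq_trans (geq_minl _ _) _.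
    exact: leq_trans (leq_pred _) (max_card _).
  by rewrite -(big_ord_widen _ (fun=> 1) le_b) sum_nat_const card_ord muln1.
rewrite -cardQ; apply: leq_trans (leq_imset_card trunc _).
apply/subset_leq_card/subsetP=> U; rewrite !inE.
case/andP=> /andP[/andP[U0 cU] sUC] /existsP[u0 /andP[u0U le_u0]].
have [u uU min_u] := arg_minnP (fun u => dist v u) u0U.
have uC : u \in v |: C by rewrite in_setU1 (subsetP sUC) ?orbT.
have [P [cP vP sP uP [cardP ltP]]] := geodesic uC.
have vNU : v \notin U := contra (subsetP sUC v) (components_notin compC).
have du_gt0 : 0 < dist v u.
  by rewrite lt0n (dist_eq0 conn_G); apply: contraNneq vNU => ->.
have lt_uG : (dist v u).-1 < #|G|.
  by rewrite prednK // ltnW // card_gt_dist.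
apply/imsetP; exists (U :|: P, Ordinal lt_uG); last first.
  apply/setP=> x; rewrite !inE /= prednK //; apply/idP/andP => [xU | [/orP[]//]].
    by rewrite xU min_u.
  by have [-> | xu xP] := eqVneq x u; rewrite // leqNgt ltP.
have le_PW : #|P| <= #|U :|: P| by apply/subset_leq_card/subsetUr.
have le_ue : dist v u <= e := leq_trans (min_u _ u0U) le_u0.
rewrite inE /= -[b _]/(minn _ _) leq_min; apply/andP; split; last first.
  move: le_PW le_ue du_gt0; rewrite cardP.
  by move: (dist v u) (#|U :|: P|) => d c; clear; lia.
apply/rootedP; split.
- exact: connected_setU uU uP.
- by rewrite sub1set inE vP orbT.
- by rewrite subUset sP (subset_trans sUC) ?subsetUr.
Qed.

Lemma card_rooted_component : 1 + #|C| <= #|F|.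
Proof.
have := leq_card_rooted connected_root_component (setU11 v C).
by rewrite cardsU1 components_notin.
Qed.

Lemma sum_minn_rooted e :
  \sum_(W in F) minn #|W|.-1 e
    <= \sum_(j < #|C|.+1) minn j e + e * (#|F| - (1 + #|C|)).
Proof.
have [B Bk] := rooted_chain connected_root_component (setU11 v C).
have cardvC : #|v |: C| = #|C|.+1 by rewrite cardsU1 components_notin.
rewrite {}cardvC in Bk.
have {}Bk (j : 'I_#|C|.+1) := Bk j.+1 (ltn_ord j).
pose B' (j : 'I_#|C|.+1) := B j.+1.
have injB : injective B'.
  move=> i j eqB; apply: val_inj; apply: succn_inj.
  by have [_ _ _ <-] := Bk i; have [_ _ _ <-] := Bk j; rewrite -/(B' i) eqB.
have sBF : B' @: [set: 'I_#|C|.+1] \subset F.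
  apply/subsetP=> _ /imsetP[j _ ->]; have [cB vB sB _] := Bk j.
  by apply/rootedP; rewrite sub1set.
rewrite (big_setID (B' @: setT)) /= (setIidPr sBF); apply: leq_add.
  rewrite big_imset /=; last by move=> i j _ _; apply: injB.
  rewrite (eq_bigl predT) => [|j]; last by rewrite inE.
  by apply: leq_sum => j _; have [_ _ _ ->] := Bk j.
apply: (@leq_trans (\sum_(W in F :\: B' @: setT) e)).
  by apply: leq_sum => W _; apply: geq_minr.
rewrite sum_nat_const mulnC leq_mul2l cardsD (setIidPr sBF) card_imset //.
by rewrite cardsT card_ord leqnn orbT.
Qed.

Lemma card_near_subconn e :
  2 * #|[set U in subconn C | [exists u in U, dist v u <= e]]|
      + (#|C| - e) * (#|C| - e).+1
    <= #|C| * #|C|.+1 + 2 * e * (#|F| - (1 + #|C|)).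
Proof.
have := leq_trans (leq_card_near_subconn e) (sum_minn_rooted e).
rewrite -(sum_minn #|C| e) => le_e.
rewrite addnAC leq_add2r -mulnA -mulnDr leq_mul2l; exact: le_e.
Qed.

(** Use [card_near_subconn] with [e] the largest distance from [v] in [C], so that no set is lost.
    Under equality the correction term vanishes, hence [#|C| <= e] and a geodesic exhausts [C]. *)
Lemma card_subconn M : 2 * ecc conn_G v <= M ->
  2 * #|subconn C| <= #|C| * #|C|.+1 + M * (#|F| - (1 + #|C|)) /\
  (2 * #|subconn C| = #|C| * #|C|.+1 + M * (#|F| - (1 + #|C|)) ->
   exists2 x, x \in C & #|C| <= dist v x).
Proof.
move=> le_eM.
have [x0 x0v def_C] := componentsP compC.
have x0C : x0 \in C by rewrite def_C mem_component.
have [x xC max_x] := arg_maxnP (fun x => dist v x) x0C.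
have -> : subconn C = [set U in subconn C | [exists u in U, dist v u <= dist v x]].
  apply/setP=> U; rewrite [RHS]inE andbC; case UC: (U \in subconn C); rewrite ?andbF //.
  move: UC; rewrite !inE andbT => /andP[/andP[/set0Pn[u uU] _] sUC].
  by apply/esym/existsP; exists u; rewrite uU; apply/max_x/(subsetP sUC).
have := card_near_subconn (dist v x).
have {le_eM} le_M : 2 * dist v x <= M.
  by apply: leq_trans le_eM; rewrite leq_mul2l dist_ecc.
move: (#|[set U in _ | _]|) (#|F| - _) => T g le_T.
have le_g : 2 * dist v x * g <= M * g by rewrite leq_mul2r le_M orbT.
split; first by lia.
by move=> eqT; exists x => //; lia.
Qed.

End ComponentBounds.

(** * The induction step *)

Section InductionStep.
Variable G : sgraph.
Hypothesis conn_G : connected G.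
Implicit Types (C U : {set G}) (v x y : G).
Let F v C := rooted [set v] (v |: C).
Let N := num_conn G.
Let S := sum_conn G.
Let M := #|G|.-1.

Lemma leq_num_sum_conn v :
    (forall C, C \in components v ->
       (#|C| + 2) * #|subconn C| <= 3 * \sum_(U in subconn C) #|U|) ->
    (forall C, C \in components v ->
       2 * #|subconn C| <= #|C| * #|C|.+1 + M * (#|F v C| - (1 + #|C|))) ->
  (#|G| + 2) * N <= 3 * S /\
  ((#|G| + 2) * N = 3 * S ->
    (forall C, C \in components v ->
       2 * #|subconn C| = #|C| * #|C|.+1 + M * (#|F v C| - (1 + #|C|)))
    /\ #|components v| <= 2).
Proof.
move=> IH leK.
have cardG : #|G| = M.+1.
  by rewrite /M prednK //; apply/card_gt0P; exists v.
have leM C : C \in components v -> #|C| <= M.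
  by move=> CP; rewrite /M -(sum_card_components v) (bigD1 C CP) leq_addr.
have := @leq_weighted_sum _ (components v) (fun C => #|C|)
  (fun C => #|F v C| - (1 + #|C|)) (fun C => #|subconn C|).
rewrite sum_card_components -/M => /(_ leK).
set s := \sum_(C in _) _; set p := \prod_(C in components v) _.
case=> le_s eq_s; set R := rooted [set v] [set: G].
have le_p : p <= #|R|.
  apply: leq_trans (leq_prod_card_rooted v); apply: leq_prod => C CP.
  by rewrite subnKC // card_rooted_component.
have le_Mp : M * p <= M * #|R| by rewrite leq_mul2l le_p orbT.
have cT : connected_set [set: G] := connected_setT conn_G.
have leR : (#|G| + 1) * #|R| <= 2 * \sum_(U in R) #|U|.
  have := @rooted_average G [set v] setT (connected_set1 v).
  rewrite cards1 cardsT; apply=> //; first by apply/set0Pn; exists v; rewrite set11.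
have IHs : \sum_(C in components v) (#|C| + 2) * #|subconn C|
    <= 3 * \sum_(C in components v) \sum_(U in subconn C) #|U|.
  by rewrite big_distrr /=; apply: leq_sum.
have splitT : s + \sum_(C in components v) (#|C| + 2) * #|subconn C|
    = (#|G| + 2) * \sum_(C in components v) #|subconn C|.
  rewrite -big_split big_distrr /=; apply: eq_bigr => C /leM le_CM.
  by rewrite [_ * (1 + M - _)]mulnC -mulnDl cardG; congr (_ * _); lia.
have splitN : N = #|R| + \sum_(C in components v) #|subconn C|.
  rewrite /N /num_conn -sum1_card (big_conn_sets_split v) sum1_card.
  by congr (_ + _); apply: eq_bigr => C _; rewrite sum1_card.
have splitS : S = \sum_(U in R) #|U|
    + \sum_(C in components v) \sum_(U in subconn C) #|U|.
  exact: big_conn_sets_split.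
(* For the sets through [v], [3 * (#|G| + 1) - 2 * (#|G| + 2) = M] yields the gain [M * p]; [2 * s]
   is the loss from having [#|C|] in place of [#|G|] in the bounds for the components. *)
have gap : 2 * ((#|G| + 2) * N) + M * p <= 2 * (3 * S) + 2 * s.
  move: splitT IHs leR le_Mp; rewrite splitN splitS cardG; clear.
  move: (#|R|) (\sum_(U in R) _) => a b.
  move: (\sum_(C in _) #|_|) (\sum_(C in _) \sum_(U in _) _) => c d.
  move: (\sum_(C in _) _) (M * p) => e q.
  by clearbody s M; lia.
clear leR IHs splitT splitN splitS le_Mp le_p.
split=> [|eqNS]; first by move: le_s gap; clear; lia.
have {gap} : 2 * s == M * p.
  by rewrite eqn_leq le_s /=; move: gap; rewrite eqNS leq_add2l.
rewrite eq_s => /andP[/andP[/forall_inP eqK /forall_inP eq_prod] _].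
split=> [C CP|]; first exact/eqP/eqK.
rewrite leqNgt; apply/negP => gt2.
have gt0 C : C \in components v -> 0 < #|C|.
  by case/componentsP=> x xv ->; apply/card_gt0P; exists x; apply: mem_component.
have [C CP] : exists C, C \in components v.
  by apply/card_gt0P; apply: leq_trans gt2.
have := ltn_term_prod CP gt0 gt2; rewrite sum_card_components -/M.
by have := eq_prod C CP; rewrite eqn_pmul2l ?gt0 // => /eqP ->; rewrite ltnn.
Qed.

Lemma path_or_ltn_sum_conn : 0 < #|G| ->
    (forall C, connected_set C -> C != set0 -> C \proper [set: G] ->
       (#|C| + 2) * #|subconn C| <= 3 * \sum_(U in subconn C) #|U|) ->
  (exists x y, #|G| <= (dist conn_G x y).+1) \/ (#|G| + 2) * N < 3 * S.
Proof.
move=> G_gt0 IH.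
have IHv v C : C \in components v ->
    (#|C| + 2) * #|subconn C| <= 3 * \sum_(U in subconn C) #|U|.
  move=> CP; apply: IH; first exact: components_connected CP.
    by have [x xv ->] := componentsP CP; apply/set0Pn; exists x; apply: mem_component.
  by rewrite properT; apply: contraNneq (components_notin CP) => ->; rewrite inE.
have cardG : #|G| = M.+1 by rewrite prednK.
have [v [lt_ecc | [w [z [cardG2 dvw dvz uniq_w cover]]]]] := central_vertex conn_G G_gt0.
  have le_ecc : 2 * ecc conn_G v <= M by rewrite mul2n -ltnS -cardG.
  have [|le_NS eq_NS] := leq_num_sum_conn (IHv v).
    by move=> C CP; have [] := card_subconn CP le_ecc.
  case: (ltngtP ((#|G| + 2) * N) (3 * S)) le_NS => // [_ _|/eq_NS[eqK le2] _]; first by right.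
  left; have far C : C \in components v ->
      exists2 x, x \in C & #|C| <= dist conn_G v x.
    by move=> CP; have [_] := card_subconn CP le_ecc; apply; apply: eqK.
  have sumC : \sum_(C in components v) #|C| = M := sum_card_components v.
  case cardP: #|components v| le2 => [|[|[|k]]] // _.
  - exists v, v; rewrite cardG -sumC.
    by move/eqP: cardP; rewrite cards_eq0 => /eqP->; rewrite big_set0.
  - have /cards1P[C def_P] := introT eqP cardP.
    have [|x xC le_x] := far C; first by rewrite def_P set11.
    have := dist_ecc conn_G v x; move: sumC; rewrite def_P big_set1 => sumC.
    (* Here [#|C| <= ecc] and [2 * ecc <= #|C|] force [#|C| = 0], so a pair at distance [0] will
       do. *)
    by exists v, v; move: le_ecc le_x; rewrite cardG -sumC; lia.
  have /cards2P[C [D [neCD def_P]]] := introT eqP cardP.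
  have CP : C \in components v by rewrite def_P !inE eqxx.
  have DP : D \in components v by rewrite def_P !inE eqxx orbT.
  have [x xC le_x] := far C CP; have [y yD le_y] := far D DP.
  (* The two geodesics join at [v], so [x] and [y] are at distance at least [#|C| + #|D| = M]. *)
  exists x, y; rewrite (dist_cut conn_G CP xC); last first.
    apply: contraNN neCD => yC.
    by rewrite (components_eq CP yC).2 (components_eq DP yD).2.
  rewrite cardG -sumC def_P big_setU1 ?inE //= big_set1 ltnS leq_add //.
  by rewrite dist_sym.
have e_gt0 : 0 < ecc conn_G v by move: G_gt0; rewrite cardG2; lia.
have wv : w != v by rewrite eq_sym -(dist_eq0 conn_G) dvw -lt0n.
pose C := component (~: [set v]) w.
have wC : w \in C := mem_component wv.
have CP : C \in components v := component_components wv.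
(* If [v] separates [w] from [z], their distance is [e + (e - 1) = #|G| - 1], with [e] the
   eccentricity of [v]. *)
have [zC | zNC] := boolP (z \in C); last first.
  left; exists w, z; rewrite (dist_cut conn_G CP wC zNC) dvz dist_sym dvw cardG2.
  by lia.
right; have [zv _] := components_eq CP zC.
(* For [x] in another component, [v] lies between [x] and both [w] and [z], against either
   alternative of [cover]. *)
have defC : C = ~: [set v].
  apply/eqP; rewrite eqEsubset component_sub; apply/subsetP=> x.
  rewrite !inE => xv; apply: contraT => xNC.
  case: (cover x xv) => [| eqd].
    by rewrite dist_sym (dist_cut conn_G CP wC xNC) [dist _ w v]dist_sym dvw; lia.
  move: eqd; rewrite [dist _ x z]dist_sym (dist_cut conn_G CP zC xNC).
  rewrite [dist _ z v]dist_sym => eqd.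
  by move: xv; rewrite eq_sym -(dist_eq0 conn_G); lia.
have cardC : #|C| = M by rewrite defC cardsC1.
have onlyC D : D \in components v -> D = C.
  move=> DP; have [x xv def_D] := componentsP DP.
  have xC : x \in C by rewrite defC !inE.
  by rewrite def_D (components_eq CP xC).2.
have ltK : 2 * #|subconn C| < #|C| * #|C|.+1 + M * (#|F v C| - (1 + #|C|)).
  have e_gt1 : 1 < ecc conn_G v.
    by move: zv; rewrite eq_sym -(dist_eq0 conn_G) dvz; lia.
  (* Cutting at [e - 1] loses at most the set [[set w]]; with [M = 2e - 1] the correction term is
     [e * (e + 1)], which exceeds the [2] owed for that set as [e > 1]. *)
  have := card_near_subconn conn_G CP (ecc conn_G v).-1.
  set near := [set U in _ | _] => le_near.
  have : #|subconn C| <= #|near|.+1.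
    rewrite -addn1 -(cards1 [set w]); apply: leq_trans (leq_card_setU _ _).
    apply/subset_leq_card/subsetP=> U UC; rewrite in_setU in_set1 inE UC /=.
    apply/orP; case: existsP => [_ | far]; [by left | right].
    move: UC; rewrite !inE => /andP[/andP[U0 _] _].
    have sUw : U \subset [set w].
      apply/subsetP=> u uU; rewrite inE; apply/eqP/uniq_w.
      have := dist_ecc conn_G v u; rewrite leq_eqVlt => /orP[/eqP // | lt_u].
      by case: far; exists u; rewrite uU -ltnS prednK.
    have [u uU] := set0Pn _ U0; have /set1P uw := subsetP sUw u uU.
    by rewrite eqEsubset sUw sub1set -uw.
  move: le_near; rewrite -/(F v C) cardC.
  have defM : M = (ecc conn_G v).*2.-1 by rewrite /M cardG2.
  move: (#|near|) (#|subconn C|) (#|F v C| - _) => a b c.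
  by move: e_gt1; rewrite defM; move: (ecc conn_G v) => e; clear; nia.
have [|le_NS eq_NS] := leq_num_sum_conn (IHv v).
  by move=> D /onlyC ->; apply: ltnW.
rewrite ltn_neqAle le_NS andbT; apply/eqP => /eq_NS[/(_ C CP) eqK _].
by rewrite eqK ltnn in ltK.
Qed.

End InductionStep.

(** * Paths *)

(** The distance from [x] takes every value below [#|G|], hence is a bijection onto ['I_#|G|]. Edges
    join consecutive levels; conversely, a geodesic meets each level in its only vertex, so
    consecutive levels are adjacent. *)
Lemma is_path_dist (G : sgraph) (conn_G : connected G) (x y : G) :
  #|G| <= (dist conn_G x y).+1 -> is_path G.
Proof.
move=> le_G; exists #|G|.
pose f u : 'I_#|G| := Ordinal (card_gt_dist conn_G x u).
have f_surj : f @: [set: G] = setT.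
  apply/setP=> i; rewrite inE; apply/imsetP.
  have [|u dxu _] := @dist_between G conn_G i x y.
    by rewrite -ltnS (leq_trans (ltn_ord i)).
  by exists u => //; apply: val_inj; rewrite /= dxu.
have inj_f : injective f.
  have /imset_injP inj : #|f @: [set: G]| == #|[set: G]|.
    by rewrite f_surj !cardsT card_ord.
  by move=> u w; apply: inj; rewrite inE.
have edge_succ u w : dist conn_G x w = (dist conn_G x u).+1 -> edge u w.
  move=> dw; have [|t dt] := @dist_between G conn_G (dist conn_G x u) x w.
    by rewrite dw.
  have -> : t = u by apply: inj_f; apply: val_inj.
  by rewrite dw subSnn => /dist1_edge.
exists f; split; first by apply: inj_card_bij; rewrite ?card_ord.
move=> u w; rewrite /= /path_edge /=; apply/orP/idP => [[/eqP/esym|/eqP/esym] | uw].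
- exact: edge_succ.
- by rewrite edge_sym; apply: edge_succ.
have : dist conn_G x u != dist conn_G x w.
  apply: contraTneq uw => eqd; have -> : u = w by apply: inj_f; apply: val_inj.
  by rewrite edge_irr.
have := dist_edge conn_G x uw; rewrite edge_sym in uw.
by have := dist_edge conn_G x uw; lia.
Qed.

Section PathCount.
Variable n : nat.
Local Notation P := (path_graph n).

Definition segment (p : 'I_n * 'I_n) : {set P} := [set k : 'I_n | p.1 <= k <= p.2].

Lemma connected_segment (p : 'I_n * 'I_n) : p.1 <= p.2 -> connected_set (segment p).
Proof.
case: p => i j /= le_ij.
apply: (@connected_set_rooted P i) => [|A y sA iA ys yNA]; first by rewrite inE leqnn.
pose Q (k : P) := (k \in segment (i, j)) && (k \notin A).
have Qy : Q y by rewrite /Q ys.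
have [k /andP[ks kNA] min_k] := arg_minnP (fun k : 'I_n => k : nat) Qy.
have [le_ik le_kj] : i <= k /\ k <= j by move: ks; rewrite inE => /andP[].
have lt_ik : i < k.
  by rewrite ltn_neqAle le_ik andbT; apply: contraNneq kNA => /val_inj <-.
have k'_lt : k.-1 < n by apply: leq_ltn_trans (leq_pred k) (ltn_ord k).
exists (Ordinal k'_lt), k; split=> //; last by rewrite /= /path_edge /=; lia.
apply: contraT => k'NA; have := min_k (Ordinal k'_lt).
by rewrite /Q inE k'NA andbT /= => /(_ _); lia.
Qed.

(** A connected set has no gap between its least and greatest elements: an edge across a missing [k]
    would join non-consecutive numbers. *)
Lemma conn_sets_path :
  conn_sets P = segment @: [set p : 'I_n * 'I_n | p.1 <= p.2].
Proof.
apply/setP=> U; rewrite inE; apply/andP/imsetP => [[/set0Pn[u uU] cU] | [p]].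
  have [i iU min_i] := arg_minnP (fun k : 'I_n => k : nat) uU.
  have [j jU max_j] := arg_maxnP (fun k : 'I_n => k : nat) uU.
  exists (i, j); first by rewrite inE /= min_i.
  apply/setP=> k; rewrite inE /=; apply/idP/andP => [kU | [le_ik le_kj]].
    by split; [apply: min_i | apply: max_j].
  apply: contraT => kNU.
  have lt_ik : i < k.
    by rewrite ltn_neqAle le_ik andbT; apply: contraNneq kNU => /val_inj <-.
  have [||||a [b []]] := connected_setP _ cU [set a in U | a < k] i j.
  - by apply/subsetP=> a; rewrite inE => /andP[].
  - by rewrite inE; apply/andP; split.
  - by [].
  - by rewrite inE negb_and -leqNgt le_kj orbT.
  rewrite !inE => /andP[aU lt_ak] bU; rewrite bU -leqNgt /= => le_kb.
  have ne_kb : k != b :> nat by apply: contraNneq kNU => /val_inj ->.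
  by rewrite /= /path_edge; lia.
rewrite inE => le_p ->; rewrite connected_segment //; split=> //.
by apply/set0Pn; exists p.1; rewrite inE leqnn.
Qed.

Lemma segment_inj : {in [set p : 'I_n * 'I_n | p.1 <= p.2] &, injective segment}.
Proof.
move=> [i j] [i' j']; rewrite !inE /= => le_ij le_ij' /setP eqs.
have := eqs i; have := eqs j; have := eqs i'; have := eqs j'.
rewrite !inE /= !leqnn le_ij le_ij' /=.
move=> /andP[h1 h2] /andP[h3 h4] /esym/andP[h5 h6] /esym/andP[h7 h8].
by congr (_, _); apply: val_inj; rewrite /=; lia.
Qed.

Lemma card_segment p : #|segment p| = p.2.+1 - p.1.
Proof.
case: p => i j; rewrite -sum1_card /=.
rewrite (eq_bigl (fun k : 'I_n => (k <= j) && (i <= k))); last first.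
  by move=> k; rewrite inE andbC.
rewrite -(big_geq_mkord _ _ (fun k => k <= j) (fun=> 1)).
rewrite -[RHS]muln1 -sum_nat_const_nat.
by rewrite (big_nat_widen _ _ _ _ _ (ltn_ord j)).
Qed.

Lemma big_conn_sets_path (phi : nat -> nat) :
  \sum_(U in conn_sets P) phi #|U| = \sum_(j < n) \sum_(i < j.+1) phi (j.+1 - i).
Proof.
rewrite conn_sets_path big_imset /=; last exact: segment_inj.
rewrite (eq_bigl (fun p : 'I_n * 'I_n => p.1 <= p.2)) => [|p]; last by rewrite inE.
rewrite (eq_bigr (fun p : 'I_n * 'I_n => phi (p.2.+1 - p.1))) => [|p _]; last first.
  by rewrite card_segment.
rewrite -(pair_big_dep predT (fun i j : 'I_n => i <= j)
            (fun i j : 'I_n => phi (j.+1 - i))) /=.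
rewrite (exchange_big_dep predT) //=; apply: eq_bigr => j _.
by rewrite (big_ord_widen _ (fun i => phi (j.+1 - i)) (ltn_ord j)).
Qed.

Lemma num_conn_path : 2 * num_conn P = n * n.+1.
Proof.
rewrite /num_conn -sum1_card (big_conn_sets_path (fun=> 1)).
under eq_bigr do rewrite sum_nat_const card_ord muln1.
elim: n => [|k IHk]; first by rewrite big_ord0.
by rewrite big_ord_recr /= mulnDr IHk; lia.
Qed.

Lemma sum_conn_path : 6 * sum_conn P = n * n.+1 * n.+2.
Proof.
rewrite /sum_conn (big_conn_sets_path id).
have tri j : 2 * \sum_(i < j) (j - i) = j * j.+1.
  elim: j => [|j IHj]; first by rewrite big_ord0.
  rewrite big_ord_recl subn0 mulnDr.
  under eq_bigr do rewrite /= /bump add1n subSS.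
  by rewrite IHj; lia.
elim: n => [|k IHk]; first by rewrite big_ord0.
rewrite big_ord_recr /= mulnDr IHk; move: (tri k.+1).
by move: (\sum_(_ < _) _) => s; nia.
Qed.

Lemma path_sum_conn : 3 * sum_conn P = (n + 2) * num_conn P.
Proof. by have := num_conn_path; have := sum_conn_path; nia. Qed.

End PathCount.

Lemma is_path_sum_conn (G : sgraph) : is_path G ->
  3 * sum_conn G = (#|G| + 2) * num_conn G.
Proof.
case=> n [f [bij_f edge_f]]; have inj_f := bij_inj bij_f.
have transport phi : \sum_(U in conn_sets G) phi #|U|
    = \sum_(U in conn_sets (path_graph n)) phi #|U|.
  rewrite -(big_conn_sets_imset inj_f edge_f); apply: eq_bigl => U.
  have -> : f @: [set: G] = setT.
    apply/setP=> y; rewrite !inE; have [g _ gK] := bij_f.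
    by apply/imsetP; exists (g y).
  by rewrite subsetT andbT.
rewrite (bij_eq_card bij_f) card_ord.
have -> : num_conn G = num_conn (path_graph n).
  by rewrite /num_conn -!sum1_card (transport (fun=> 1)).
by rewrite /sum_conn (transport id); apply: path_sum_conn.
Qed.

(** Strong induction on the order. The disjunction carries the bound and its equality case together:
    a smaller induced subgraph is a path, with equality by [is_path_sum_conn], or satisfies the
    strict inequality. *)
Lemma sum_conn_lower_bound (G : sgraph) : 0 < #|G| -> connected G ->
  is_path G \/ (#|G| + 2) * num_conn G < 3 * sum_conn G.
Proof.
have [k] := ubnP #|G|; elim: k G => // k IHk G le_k G_gt0 conn_G.
have [||[x [y le_xy]] | lt_NS] := path_or_ltn_sum_conn conn_G; [by [] | | | by right].
  move=> C cC C0 ltC.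
  have cardC : #|induced C| = #|C| by rewrite card_sig; apply: eq_card.
  have [|||pathC | ltC'] := IHk (induced C).
  - rewrite cardC; apply: leq_trans (proper_card ltC) _.
    by rewrite cardsT -ltnS.
  - by rewrite cardC card_gt0.
  - by [].
  - by rewrite -num_conn_induced -sum_conn_induced (is_path_sum_conn pathC) cardC.
  by rewrite -num_conn_induced -sum_conn_induced -cardC ltnW.
by left; apply: is_path_dist le_xy.
Qed.

(** * Passage to rational averages *)

Local Open Scope ring_scope.

Theorem theorem1p1 (G : sgraph) (n : nat) (order_n : gorder G = n)
    (n_gt0 : (0 < n)%N) (conn_G : connected G) :
  [/\ avg_conn G >= (n%:R + 2) / 3,
      avg_conn G = (n%:R + 2) / 3 <-> is_path G
    & density G > 1 / 3].
Proof.
have G_gt0 : (0 < #|G|)%N by rewrite -/(gorder G) order_n.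
have lower := sum_conn_lower_bound G_gt0 conn_G.
have num_gt0 : (0 < num_conn G)%N.
  have [v _] := card_gt0P G_gt0; apply/card_gt0P; exists [set v].
  by rewrite inE connected_set1 andbT; apply/set0Pn; exists v; rewrite set11.
have cardG : #|G| = n := order_n; rewrite cardG in lower.
have path_eq : is_path G -> (3 * sum_conn G = (n + 2) * num_conn G)%N.
  by move/is_path_sum_conn; rewrite cardG.
have N_gt0 : 0 < (num_conn G)%:R :> rat by rewrite ltr0n.
have avg_ge : avg_conn G >= (n%:R + 2) / 3.
  rewrite /avg_conn ler_pdivlMr // mulrAC ler_pdivrMr // -natrD -!natrM ler_nat.
  by rewrite [leqRHS]mulnC; case: lower => [/path_eq -> | /ltnW].
split=> //.
  split=> [avg_eq | /path_eq pathE].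
    case: lower => //; move/eqP: avg_eq; rewrite /avg_conn eqr_div ?pnatr_eq0 -?lt0n //.
    by rewrite -natrD -!natrM eqr_nat mulnC => /eqP ->; rewrite ltnn.
  apply/eqP; rewrite /avg_conn eqr_div ?pnatr_eq0 -?lt0n //.
  by rewrite -natrD -!natrM eqr_nat mulnC pathE.
(* The summand [2] in the bound on the average makes this strict even for paths. *)
rewrite /density order_n ltr_pdivlMr ?ltr0n //; apply: lt_le_trans avg_ge.
by rewrite mulrAC mul1r ltr_pM2r ?invr_gt0 // ltrDl.
Qed.
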